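(* Let a sensing matrix $A\in\mathbb{R}^{m\times n}$, a representation structure $\mathcal{S}=(B,n_1,\dots,n_K,\|\cdot\|_{(1)},\dots,\|\cdot\|_{(K)})$ with $N=n_1+\cdots+n_K$, a positive integer $s\le K$, $q\in[1,\infty]$ and $\kappa\ge0$ be given. For an $N\times N$ block matrix $V=[V^{k\ell}]_{k,\ell=1}^K$, $V^{k\ell}\in\mathbb{R}^{n_k\times n_\ell}$, let $\Omega$ be the $K\times K$ matrix with entries $[\Omega]_{k,\ell}=\|V^{k\ell}\|_{(\ell,k)}$, $1\le k,\ell\le K$. Then $$\widehat{\nu}_{s,q}(V):=\max_{1\le k\le K}\|\mathrm{Col}_k[\Omega]\|_{s,q}\ \ge\ \nu^*_{s,q}(V)\qquad\forall V,$$ where $$\nu^*_{s,q}(V)=\max_{1\le\ell\le K}\ \max_{w^\ell\in\mathbb{R}^{n_\ell}:\ \|w^\ell\|_{(\ell)}\le1}L_{s,q}\big([V^{1\ell}w^\ell;\dots;V^{K\ell}w^\ell]\big),$$ and the inequality becomes an equality when either $q=\infty$ or $s=1$. Consequently, for $H\in\mathbb{R}^{m\times N}$, the existence of $V$ such that $$B=VB+H^TA\qquad\text{and}\qquad\widehat{\nu}_{s,q}(V)\le s^{1/q-1}\kappa$$ is sufficient for the pair $(H,L_\infty(\cdot))$ to satisfy the condition $\mathbf{Q}_{s,q}(\kappa)$ associated with $A$ and $\mathcal{S}$.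
   Context: A representation structure (r.s.) $\mathcal{S}=(B,n_1,\dots,n_K,\|\cdot\|_{(1)},\dots,\|\cdot\|_{(K)})$ consists of positive integers $n_1,\dots,n_K$ with $N=n_1+\cdots+n_K$, a matrix $B=[B[1];\dots;B[K]]\in\mathbb{R}^{N\times n}$ (vertical concatenation, $B[k]\in\mathbb{R}^{n_k\times n}$), and norms $\|\cdot\|_{(k)}$ on $\mathbb{R}^{n_k}$. Vectors $w\in\mathbb{R}^N=\mathbb{R}^{n_1}\times\cdots\times\mathbb{R}^{n_K}$ are written in blocks $w=[w[1];\dots;w[K]]$, $w[k]\in\mathbb{R}^{n_k}$; the magnitude of block $k$ is $\|w[k]\|_{(k)}$. For $1\le p\le\infty$, $L_p(w)=\|[\|w[1]\|_{(1)};\dots;\|w[K]\|_{(K)}]\|_p$. The vector $w^s$ is obtained from $w$ by zeroing out all but the $s$ blocks largest in magnitude (ties resolved arbitrarily), and $L_{s,p}(w)=L_p(w^s)$. Convention: $1/\infty=0$. $\|M\|_{(\ell,k)}$ is the norm of the linear mapping $u\mapsto Mu:\mathbb{R}^{n_\ell}\to\mathbb{R}^{n_k}$ induced by the norms $\|\cdot\|_{(\ell)}$ on the argument and $\|\cdot\|_{(k)}$ on the image space. $\mathrm{Col}_k[M]$ is the $k$th column of $M$. For a vector $u\in\mathbb{R}^K$, $\|u\|_{s,q}$ is the $\ell_q$-norm of the vector obtained from $u$ by zeroing all but the $s$ largest in magnitude entries. Condition $\mathbf{Q}_{s,q}(\kappa)$ associated with $A$ and $\mathcal{S}$: a pair $(H,\|\cdot\|)$,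 $H\in\mathbb{R}^{m\times M}$, $\|\cdot\|$ a norm on $\mathbb{R}^M$, satisfies it if $$L_{s,q}(Bx)\le s^{1/q}\|H^TAx\|+\kappa s^{1/q-1}L_1(Bx)\qquad\forall x\in\mathbb{R}^n.$$ *)

(* Defs.v *)
From HB Require Import structures.
From mathcomp Require Import all_boot all_order all_algebra.
From mathcomp Require Import all_classical all_reals all_analysis.

Set Implicit Arguments.
Unset Strict Implicit.
Unset Printing Implicit Defensive.

Import Order.TTheory GRing.Theory Num.Theory.

Local Open Scope classical_set_scope.
Local Open Scope ring_scope.

Definition is_norm (R : realType) (d : nat) (f : 'cV[R]_d -> R) : Prop :=
  [/\ forall u, f u = 0 -> u = 0,
      forall (a : R) u, f (a *: u) = `|a| * f u
    & forall u v, f (u + v) <= f u + f v].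

Definition opnorm (R : realType) (d1 d2 : nat)
    (f : 'cV[R]_d1 -> R) (g : 'cV[R]_d2 -> R) (M : 'M[R]_(d2, d1)) : R :=
  sup [set g (M *m u) | u in [set u | f u <= 1]].

(* 1/p for an exponent p in [1, +oo], with 1/oo = 0. *)
Definition invexp (R : realType) (p : \bar R) : R :=
  if p is r%:E then r^-1 else 0.

(* The l_p norm on R^d, for p in [1, +oo]. *)
Definition ellnorm (R : realType) (p : \bar R) (d : nat) (u : 'cV[R]_d) : R :=
  if p is r%:E then (\sum_(i < d) `|u i 0| `^ r) `^ r^-1
  else \big[Num.max/0]_(i < d) `|u i 0|.

(* The indices of s largest values of a (all indices if d < s), obtained by
   sorting in nonincreasing order; the sort is stable, so ties are resolved in
   favour of smaller indices. *)
Definition largest (R : realType) (s d : nat) (a : 'I_d -> R) : {set 'I_d} :=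
  [set i in take s (sort (fun i j => a j <= a i) (enum 'I_d))].

Lemma card_largest (R : realType) (s d : nat) (a : 'I_d -> R) :
  (s <= d)%N -> #|largest s a| = s.
Proof.
move=> sd; rewrite cardsE; have /card_uniqP -> :
    uniq (take s (sort (fun i j => a j <= a i) (enum 'I_d))).
  by rewrite take_uniq // sort_uniq enum_uniq.
by rewrite size_takel // size_sort size_enum_ord.
Qed.

Lemma largestP (R : realType) (s d : nat) (a : 'I_d -> R) (i j : 'I_d) :
  i \in largest s a -> j \notin largest s a -> a j <= a i.
Proof.
rewrite !inE; set r := fun i j => a j <= a i; set t := sort r _ => it jt.
have jd : j \in drop s t.
  have : j \in take s t ++ drop s t by rewrite cat_take_drop mem_sort mem_enum.
  by rewrite mem_cat (negPf jt).
have rt : transitive r by move=> x y z /[swap]; exact: le_trans.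
have : sorted r t by apply: sort_sorted => x y; exact: le_total.
rewrite (sorted_pairwise rt) -(cat_take_drop s t) pairwise_cat.
by move=> /and3P[/allrelP + _ _]; exact.
Qed.

(* ||u||_{s,p}: the l_p norm of u with all but its s largest in magnitude
   entries zeroed out. *)
Definition sellnorm (R : realType) (s : nat) (p : \bar R) (d : nat)
    (u : 'cV[R]_d) : R :=
  ellnorm p (\col_i (if i \in largest s (fun k => `|u k 0|) then u i 0 else 0)).

Record repr_struct (R : realType) (n : nat) := ReprStruct {
  nblocks : nat;
  bdim : 'I_nblocks -> nat;
  bdim_gt0 : forall k, (0 < bdim k)%N;
  rsB : 'M[R]_(\sum_(k < nblocks) bdim k, n);
  bnorm : forall k, 'cV[R]_(bdim k) -> R;
  bnormP : forall k, is_norm (@bnorm k) }.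

Arguments nblocks {R n} _.
Arguments bdim {R n} _ _.
Arguments rsB {R n} _.
Arguments bnorm {R n} _ _ _.

Section ReprStructNorms.
Variables (R : realType) (n : nat) (S : repr_struct R n).

Implicit Types (w : 'cV[R]_(\sum_(k < nblocks S) bdim S k)).
Implicit Types (V : 'M[R]_(\sum_(k < nblocks S) bdim S k,
                           \sum_(k < nblocks S) bdim S k)).

(* The magnitude ||w[k]||_(k) of the k-th block of w. *)
Definition bmag w (k : 'I_(nblocks S)) : R := bnorm S k (submxcol w k).

Definition Lp (p : \bar R) w : R := ellnorm p (\col_k bmag w k).

(* The vector w^s. *)
Definition btrunc (s : nat) w : 'cV[R]_(\sum_(k < nblocks S) bdim S k) :=
  \mxcol_k (if k \in largest s (bmag w) then submxcol w k else 0).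

Definition Lsp (s : nat) (p : \bar R) w : R := Lp p (btrunc s w).

Definition Omega V : 'M[R]_(nblocks S) :=
  \matrix_(k, l) opnorm (bnorm S l) (bnorm S k) (submxblock V k l).

Definition nuhat (s : nat) (q : \bar R) V : R :=
  \big[Num.max/0]_(k < nblocks S) sellnorm s q (col k (Omega V)).

(* L_{s,q}([V^{1l} u; ...; V^{Kl} u]) *)
Definition nuval (s : nat) (q : \bar R) V (l : 'I_(nblocks S))
    (u : 'cV[R]_(bdim S l)) : R :=
  Lsp s q (\mxcol_k (submxblock V k l *m u)).

(* nu^*_{s,q}(V); the inner maximum over the unit ball is written as a sup. *)
Definition nustar (s : nat) (q : \bar R) V : R :=
  \big[Num.max/0]_(l < nblocks S)
    sup [set nuval s q V u | u in [set u | bnorm S l u <= 1]].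

(* Condition Q_{s,q}(kappa) for the pair (H, nrm). *)
Definition condQ (m M : nat) (A : 'M[R]_(m, n)) (s : nat) (q : \bar R)
    (kappa : R) (H : 'M[R]_(m, M)) (nrm : 'cV[R]_M -> R) : Prop :=
  is_norm nrm /\
  forall x : 'cV[R]_n,
    Lsp s q (rsB S *m x) <=
      s%:R `^ invexp q * nrm (H^T *m A *m x)
      + kappa * s%:R `^ (invexp q - 1) * Lp 1%:E (rsB S *m x).

End ReprStructNorms.

(* Main.v *)
Require Import Defs.
From HB Require Import structures.
From mathcomp Require Import all_boot all_order all_algebra.
From mathcomp Require Import all_classical all_reals all_analysis.
From mathcomp Require Import ring.

Set Implicit Arguments.
Unset Strict Implicit.
Unset Printing Implicit Defensive.

Import Order.TTheory GRing.Theory Num.Theory.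
Import numFieldNormedType.Exports.
Local Open Scope classical_set_scope.
Local Open Scope ring_scope.

(** Write L for L_{s,q}.  The proof rests on two facts.  The first is that L is
    a seminorm on the space of block vectors, monotone in the block magnitudes.
    This is not visible from its definition by sorting, since the selected
    blocks depend on the vector; but L(w) is also the largest l_q norm of the magnitudes of
    w restricted to at most s blocks (ellnorm_restrict_le), and a maximum of
    monotone seminorms is one (sellnorm_le, sellnorm_seminorm).

    The second fact is that on R^d a seminorm g attains its maximum over the
    unit ball of a norm f (seminorm_attains_max), because this ball is compact.
    Hence the suprema that define the operator norms [Omega]_{k,l} and nu^*
    are values g(u) with f(u) <= 1, and g <= (sup g) * f by homogeneity.

    - nu^* <= nuhat: if ||u||_(l) <= 1, the k-th block V^{kl} u has magnitude at
      most [Omega]_{k,l}, so by monotonicity L of the image of u is at most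
      ||Col_l[Omega]||_{s,q}.
    - Equality when q = oo or s = 1: in both cases s^{1/q} = 1, and the
      inequalities max_k |u_k| <= ||u||_{s,q} <= s^{1/q} max_k |u_k| make
      ||.||_{s,q} the max norm.  Then nuhat is the largest [Omega]_{k,l}; a vector
      u of the unit ball attaining it has an image whose k-th block alone
      already has that magnitude, so nu^* >= [Omega]_{k,l}.
    - Condition Q: with w = Bx, the hypothesis reads w = Vw + H^T A x.  By
      subadditivity L(w) <= L(Vw) + L(H^T A x), where
      L(H^T A x) <= s^{1/q} L_oo(H^T A x), and splitting V into block columns
      gives L(Vw) <= sum_l nu^*(V) ||w[l]||_(l) = nu^*(V) L_1(w)
      (Lsp_mulmx_le), at most nuhat(V) L_1(w) <= kappa s^{1/q-1} L_1(w). *)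

(** * Seminorms *)

Definition is_seminorm (R : realType) (V : lmodType R) (f : V -> R) : Prop :=
  (forall (a : R) u, f (a *: u) = `|a| * f u) /\
  (forall u v, f (u + v) <= f u + f v).

Section Seminorm.
Context {R : realType} {V : lmodType R} {f : V -> R}.
Hypothesis hf : is_seminorm f.

Lemma seminorm0 : f 0 = 0.
Proof. by case: hf => hZ _; rewrite -(scale0r 0) hZ normr0 mul0r. Qed.

Lemma seminormN u : f (- u) = f u.
Proof. by case: hf => hZ _; rewrite -scaleN1r hZ normrN1 mul1r. Qed.

Lemma seminorm_ge0 u : 0 <= f u.
Proof.
have [_ hD] := hf; have := hD u (- u).
by rewrite subrr seminorm0 seminormN -mulr2n pmulrn_lge0.
Qed.

Lemma seminorm_sum (I : finType) (F : I -> V) :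
  f (\sum_i F i) <= \sum_i f (F i).
Proof.
elim/big_ind2 : _ => // [|x1 x2 y1 y2 h1 h2]; first by rewrite seminorm0.
by apply: le_trans (proj2 hf _ _) _; exact: lerD.
Qed.

Lemma seminorm_distl u v : `|f u - f v| <= f (u - v).
Proof.
have [_ hD] := hf.
have key x y : f x - f y <= f (x - y).
  by rewrite lerBlDr; apply: le_trans (hD _ _); rewrite subrK.
by rewrite ler_norml key andbT lerNl opprB -(seminormN (u - v)) opprB.
Qed.

Lemma seminorm_comp (W : lmodType R) (g : {linear W -> V}) :
  is_seminorm (fun u => f (g u)).
Proof.
by case: hf => hZ hD; split=> [a u|u v]; rewrite ?linearZ ?linearD //= ?hZ.
Qed.

End Seminorm.

Lemma is_norm_seminorm (R : realType) d (f : 'cV[R]_d -> R) :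
  is_norm f -> is_seminorm f.
Proof. by case. Qed.

(** * Suprema of seminorms over unit balls *)

Section RowSpace.
Context {R : realType} {d : nat}.
Implicit Types f g : 'rV[R]_d -> R.

Lemma ler_mx_norm_entry (u : 'rV[R]_d) i : `|u 0 i| <= `|u|.
Proof.
rewrite [leRHS]/Num.norm /= mx_normrE.
exact: (le_bigmax _ (fun ij : 'I_1 * 'I_d => `|u ij.1 ij.2|) (0, i)).
Qed.

(** Expanding u in the standard basis e_i gives the constant
    C = sum_i f(e_i). *)
Lemma seminorm_bounded f : is_seminorm f ->
  exists2 C, 0 <= C & forall u, f u <= C * `|u|.
Proof.
move=> hf; exists (\sum_i f (delta_mx 0 i)).
  by apply: sumr_ge0 => i _; exact: seminorm_ge0.
move=> u; rewrite {1}(row_sum_delta u) mulr_suml.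
apply: le_trans (seminorm_sum hf _) _; apply: ler_sum => i _.
rewrite (proj1 hf) mulrC ler_wpM2l ?(seminorm_ge0 hf)//.
exact: ler_mx_norm_entry.
Qed.

Lemma seminorm_continuous f : is_seminorm f -> continuous f.
Proof.
move=> hf u; have [C C0 fC] := seminorm_bounded hf.
apply/(@cvgrPdist_le _ _ _ (nbhs u)) => /= e e0.
(* The constant C may vanish, so C + 1 serves as Lipschitz constant. *)
have C1 : 0 < C + 1 by rewrite ltr_wpDl.
have de : 0 < e / (C + 1) by rewrite divr_gt0.
have nv : \forall v \near u, `|u - v| <= e / (C + 1).
  by apply: (@cvgr_dist_le _ _ _ (nbhs u) _ id u) de; exact: cvg_id.
apply: filterS nv => v nv.
apply: le_trans (seminorm_distl hf _ _) _.
apply: le_trans (fC _) _.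
apply: (@le_trans _ _ ((C + 1) * `|u - v|)).
  by rewrite ler_wpM2r// lerDl.
by rewrite mulrC -ler_pdivlMr.
Qed.

Lemma sphere_compact : compact [set u : 'rV[R]_d | `|u| = 1].
Proof.
apply: bounded_closed_compact.
  exists 1; split; first exact: num_real.
  by move=> x x1 u /= ->; exact: ltW.
have -> : [set u : 'rV[R]_d | `|u| = 1] = Num.norm @^-1` [set 1 : R] by [].
by apply: closed_comp; [move=> *; exact: norm_continuous | exact: closed_eq].
Qed.

(** The constant is the minimum of f over the max-norm unit sphere, which is
    positive because f vanishes only at 0.  For d = 0 the sphere is empty and
    any constant will do. *)
Lemma norm_coercive f : is_seminorm f -> (forall u, f u = 0 -> u = 0) ->
  exists2 c, 0 < c & forall u, c * `|u| <= f u.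
Proof.
move=> hf f0.
have [u0|nosphere] := pselect ([set u : 'rV[R]_d | `|u| = 1] !=set0); last first.
  exists 1 => // u; have [->|un0] := eqVneq u 0.
    by rewrite normr0 mulr0 (seminorm_ge0 hf).
  case: nosphere; exists (`|u|^-1 *: u) => /=.
  by rewrite normrZ normfV normr_id mulVf// normr_eq0.
have [|c /set_mem /= c1 cmin] := EVT_min_rV u0 sphere_compact (f := f).
  by apply: continuous_subspaceT; exact: seminorm_continuous.
exists (f c).
  rewrite lt0r (seminorm_ge0 hf) andbT; apply/eqP => /f0 c0.
  by move: c1; rewrite c0 normr0 => /eqP; rewrite eq_sym oner_eq0.
move=> u; have [->|un0] := eqVneq u 0.
  by rewrite normr0 mulr0 (seminorm_ge0 hf).
have u_gt0 : 0 < `|u| by rewrite normr_gt0.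
have := cmin (`|u|^-1 *: u); rewrite inE /= (proj1 hf) normrZ normfV normr_id.
by rewrite mulVf ?gt_eqF// => /(_ erefl); rewrite mulrC ler_pdivlMr.
Qed.

(** Coercivity bounds the unit ball of f and continuity closes it, so it is
    compact and the extreme value theorem applies to g. *)
Lemma seminorm_attains_max f g : is_seminorm f -> (forall u, f u = 0 -> u = 0) ->
  is_seminorm g ->
  exists2 u, f u <= 1 & forall v, f v <= 1 -> g v <= g u.
Proof.
move=> hf f0 hg; have [c c0 cf] := norm_coercive hf f0.
have B0 : [set u | f u <= 1] !=set0 by exists 0 => /=; rewrite (seminorm0 hf).
have Bc : compact [set u | f u <= 1].
  apply: bounded_closed_compact.
    exists c^-1; split; first exact: num_real.
    move=> x cx u /= fu; apply: le_trans (ltW cx).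
    by rewrite -[leRHS]mul1r ler_pdivlMr// mulrC; exact: le_trans (cf u) fu.
  have -> : [set u | f u <= 1] = f @^-1` [set x | x <= 1] by [].
  by apply: closed_comp; [move=> *; exact: seminorm_continuous | exact: closed_le].
have [|u /set_mem /= fu umax] := EVT_max_rV (f := g) B0 Bc.
  by apply: continuous_subspaceT; exact: seminorm_continuous.
by exists u => // v fv; apply: umax; rewrite inE.
Qed.

End RowSpace.

(** In the two applications g(u) is ||V^{kl} u||_(k), with supremum the operator
    norm [Omega]_{k,l}, or L_{s,q} of the image of u under a block column of V,
    with supremum a term of nu^*. *)
Section BallSup.
Context {R : realType} {d : nat} {f g : 'cV[R]_d -> R}.
Hypotheses (hf : is_norm f) (hg : is_seminorm g).

Let ballsup := sup [set g u | u in [set u | f u <= 1]].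

(** Transposition carries the maximum over to column vectors from row vectors,
    the setting of the compactness criterion. *)
Lemma ball_max : exists2 u, f u <= 1 & forall v, f v <= 1 -> g v <= g u.
Proof.
have hT (h : 'cV[R]_d -> R) (hh : is_seminorm h) :
    is_seminorm (fun u : 'rV[R]_d => h u^T) by exact: (seminorm_comp hh trmx).
have [|u fu umax] := seminorm_attains_max (hT _ (is_norm_seminorm hf)) _
  (hT _ hg).
  by case: hf => f0 _ _ u /f0 /(congr1 trmx); rewrite trmxK trmx0.
exists u^T => // v fv; have := umax v^T; rewrite trmxK; exact.
Qed.

Lemma ball_sup_ub u : f u <= 1 -> g u <= ballsup.
Proof.
move=> fu; have [v fv vmax] := ball_max.
apply: ub_le_sup; last by exists u.
by exists (g v) => _ [w fw <-]; exact: vmax.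
Qed.

Lemma ball_sup_attained : exists2 u, f u <= 1 & ballsup = g u.
Proof.
have [u fu umax] := ball_max; exists u => //.
apply/eqP; rewrite eq_le ball_sup_ub// andbT.
apply: ge_sup; first by exists (g u), u.
by move=> _ [v fv <-]; exact: umax.
Qed.

Lemma ball_sup_ge0 : 0 <= ballsup.
Proof. by have [u _ ->] := ball_sup_attained; exact: seminorm_ge0. Qed.

(** By homogeneity, from the bound at the normalised vector u / f(u); if
    f(u) = 0 then u = 0 and both sides vanish. *)
Lemma ball_sup_le u : g u <= ballsup * f u.
Proof.
have hf' := is_norm_seminorm hf.
have [fu0|fu0] := eqVneq (f u) 0.
  by case: hf => /(_ _ fu0) -> _ _; rewrite (seminorm0 hg) (seminorm0 hf') mulr0.
have fu : 0 < f u by rewrite lt0r fu0 (seminorm_ge0 hf').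
have := @ball_sup_ub ((f u)^-1 *: u).
rewrite (proj1 hf') (proj1 hg) ger0_norm ?invr_ge0 ?(ltW fu)// mulVf//.
by move=> /(_ (lexx _)); rewrite mulrC ler_pdivrMr.
Qed.

End BallSup.

(** * The l_p norms and their s-largest-entries versions *)

Section EllNorm.
Context {R : realType}.
Implicit Types p : \bar R.

Lemma ellnormK d r (u : 'cV[R]_d) : 0 < r ->
  ellnorm r%:E u `^ r = \sum_i `|u i 0| `^ r.
Proof.
move=> r0; rewrite /ellnorm -powRrM mulVf ?gt_eqF// powRr1//.
by apply: sumr_ge0 => i _; exact: powR_ge0.
Qed.

Lemma ellnorm_ge0 p d (u : 'cV[R]_d) : 0 <= ellnorm p u.
Proof.
by case: p => [r||]; rewrite /ellnorm ?powR_ge0//; exact: bigmax_ge_id.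
Qed.

Lemma ellnorm_le p d (u v : 'cV[R]_d) : (1%:E <= p)%E ->
  (forall i, `|u i 0| <= `|v i 0|) -> ellnorm p u <= ellnorm p v.
Proof.
case: p => [r r1 uv||//]; last by move=> _ uv; exact: le_bigmax2.
have r0 : 0 <= r by rewrite (le_trans ler01) -?lee_fin.
have sum0 (w : 'cV[R]_d) : \sum_i `|w i 0| `^ r \is Num.nneg.
  by rewrite nnegrE; apply: sumr_ge0 => i _; exact: powR_ge0.
rewrite /ellnorm ge0_ler_powR ?invr_ge0//; apply: ler_sum => i _.
by rewrite ge0_ler_powR ?nnegrE.
Qed.

Lemma ellnormZ p d (a : R) (u : 'cV[R]_d) : (1%:E <= p)%E ->
  ellnorm p (a *: u) = `|a| * ellnorm p u.
Proof.
case: p => [r r1||//]; last first.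
  move=> _; rewrite /ellnorm; elim/big_ind2 : _ => [|x x' y y' -> ->|i _].
  - by rewrite mulr0.
  - by rewrite maxr_pMr.
  - by rewrite mxE normrM.
have r0 : 0 < r by rewrite (lt_le_trans ltr01) -?lee_fin.
rewrite /ellnorm; under eq_bigr do rewrite mxE normrM powRM//.
rewrite -mulr_sumr powRM ?powR_ge0//; last first.
  by apply: sumr_ge0 => i _; exact: powR_ge0.
by rewrite -powRrM mulfV ?gt_eqF// powRr1.
Qed.

Lemma ellnorm_eq0 r d (u : 'cV[R]_d) : 0 < r -> ellnorm r%:E u = 0 -> u = 0.
Proof.
move=> r0 u0; apply/matrixP => i j; rewrite ord1 mxE.
have /eqP := ellnormK u r0; rewrite u0 powR0 ?(gt_eqF r0)// eq_sym psumr_eq0.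
  move=> /allP /(_ i); rewrite mem_index_enum => /(_ isT) /=.
  by rewrite powR_eq0 normr_eq0 => /andP[/eqP].
by move=> k _; exact: powR_ge0.
Qed.

Lemma powR_convex (r t x y : R) : 1 <= r -> 0 <= t <= 1 -> 0 <= x -> 0 <= y ->
  (t * x + (1 - t) * y) `^ r <= t * x `^ r + (1 - t) * y `^ r.
Proof.
move=> r1 /andP[t0 t1] x0 y0.
by apply: (convex_powR r1 (Itv01 t0 t1)); rewrite inE /= in_itv /= ?x0 ?y0.
Qed.

(** Convexity of z^r at x + y = (a + b) (t (x/a) + (1 - t) (y/b)) with
    t = a/(a + b).  Summed over the coordinates of two vectors of l_r norms a
    and b, it yields Minkowski's inequality, for both quotient sums become 1. *)
Lemma powR_addition_le (r a b x y : R) :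
  1 <= r -> 0 < a -> 0 < b -> 0 <= x -> 0 <= y ->
  (x + y) `^ r <=
    (a + b) `^ r * (a / (a + b) * (x `^ r / a `^ r)
                    + b / (a + b) * (y `^ r / b `^ r)).
Proof.
move=> r1 a0 b0 x0 y0; have ab0 : 0 < a + b by exact: addr_gt0.
have powR_quot (z c : R) : 0 <= z -> 0 < c -> z `^ r / c `^ r = (z / c) `^ r.
  move=> z0 c0; apply: (canLR (mulfK _)); first exact/lt0r_neq0/powR_gt0.
  by rewrite -powRM ?divr_ge0 ?(ltW c0)// divfK ?lt0r_neq0.
have bE : b / (a + b) = 1 - a / (a + b) by field; exact: lt0r_neq0.
have t01 : 0 <= a / (a + b) <= 1.
  by rewrite divr_ge0 ?(ltW a0) ?(ltW ab0)//= ler_pdivrMr// mul1r lerDl ltW.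
have xa : 0 <= x / a by rewrite divr_ge0// ltW.
have yb : 0 <= y / b by rewrite divr_ge0// ltW.
rewrite !powR_quot// bE.
apply: le_trans (ler_wpM2l (powR_ge0 _ _) (powR_convex r1 t01 xa yb)).
rewrite -bE -powRM ?(ltW ab0)//; last first.
  by rewrite addr_ge0// mulr_ge0// divr_ge0// ltW.
rewrite le_eqVlt; apply/orP; left; apply/eqP; congr (_ `^ r).
by field; rewrite !lt0r_neq0.
Qed.

Lemma ellnorm_minkowski r d (u v : 'cV[R]_d) : 1 <= r ->
  ellnorm r%:E (u + v) <= ellnorm r%:E u + ellnorm r%:E v.
Proof.
move=> r1; have r0 : 0 < r by rewrite (lt_le_trans ltr01).
have [/(ellnorm_eq0 r0) ->|a0] := eqVneq (ellnorm r%:E u) 0.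
  by rewrite add0r lerDr ellnorm_ge0.
have [/(ellnorm_eq0 r0) ->|b0] := eqVneq (ellnorm r%:E v) 0.
  by rewrite addr0 lerDl ellnorm_ge0.
(* Only the values a, b of the two norms and of their r-th powers matter from
   here on. *)
have := ellnormK u r0; have := ellnorm_ge0 r%:E u; move: a0.
move: (ellnorm r%:E u) => a a0 a_ge0 aE.
have := ellnormK v r0; have := ellnorm_ge0 r%:E v; move: b0.
move: (ellnorm r%:E v) => b b0 b_ge0 bE.
have {}a0 : 0 < a by rewrite lt0r a0.
have {}b0 : 0 < b by rewrite lt0r b0.
have ab_ge0 : 0 <= a + b by exact: addr_ge0.
have ar0 : a `^ r != 0 by exact/lt0r_neq0/powR_gt0.
have br0 : b `^ r != 0 by exact/lt0r_neq0/powR_gt0.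
rewrite -[leRHS](powRr1 ab_ge0) -(mulfV (lt0r_neq0 r0)) powRrM.
rewrite /ellnorm ge0_ler_powR ?invr_ge0 ?(ltW r0) ?nnegrE ?powR_ge0//.
  by apply: sumr_ge0 => i _; exact: powR_ge0.
apply: (@le_trans _ _ (\sum_i (a + b) `^ r *
    (a / (a + b) * (`|u i 0| `^ r / a `^ r)
     + b / (a + b) * (`|v i 0| `^ r / b `^ r)))).
  apply: ler_sum => i _; apply: le_trans (powR_addition_le r1 a0 b0 _ _) => //.
  by rewrite mxE ge0_ler_powR ?nnegrE ?(ltW r0) ?addr_ge0 ?ler_normD.
rewrite -mulr_sumr big_split /= -!mulr_sumr -!mulr_suml -aE -bE.
by rewrite !mulfV// !mulr1 -mulrDl mulfV ?mulr1// lt0r_neq0 ?addr_gt0.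
Qed.

Lemma ellnorm_seminorm p d : (1%:E <= p)%E ->
  is_seminorm (@ellnorm R p d).
Proof.
move=> p1; split=> [a u|u v]; first exact: ellnormZ.
case: p p1 => [r r1||//]; first exact: ellnorm_minkowski.
move=> _; rewrite {1}/ellnorm; apply: bigmax_le => [|i _].
  by rewrite addr_ge0 ?ellnorm_ge0.
rewrite mxE; apply: le_trans (ler_normD _ _) _.
by apply: lerD; exact: le_bigmax.
Qed.

End EllNorm.

Section SEllNorm.
Context {R : realType}.
Variables (s d : nat) (p : \bar R).
Hypotheses (s_le : (s <= d)%N) (p1 : (1%:E <= p)%E).
Implicit Types (u v : 'cV[R]_d) (I J : {set 'I_d}).

Definition restrict I u : 'cV[R]_d := \col_i (if i \in I then u i 0 else 0).

Lemma restrictD I u v : restrict I (u + v) = restrict I u + restrict I v.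
Proof. by apply/matrixP => i j; rewrite !mxE; case: ifP; rewrite ?addr0. Qed.

Lemma restrictZ I (a : R) u : restrict I (a *: u) = a *: restrict I u.
Proof. by apply/matrixP => i j; rewrite !mxE; case: ifP; rewrite ?mulr0. Qed.

Lemma sellnorm_restrict u : exists2 J : {set 'I_d},
  #|J| = s & sellnorm s p u = ellnorm p (restrict J u).
Proof.
by exists (largest s (fun k => `|u k 0|)); first exact: card_largest.
Qed.

(** Discarding the common part of I and J, let c be the largest value of F on
    I \ J.  The sum over I \ J is at most c |I \ J| <= c |J \ I|, which is at
    most the sum over J \ I since F >= c there. *)
Lemma ler_sum_dominating (F : 'I_d -> R) I J : (forall i, 0 <= F i) ->
  (#|I| <= #|J|)%N ->
  (forall i j, i \in I :\: J -> j \in J :\: I -> F i <= F j) ->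
  \sum_(i in I) F i <= \sum_(i in J) F i.
Proof.
move=> F0 IJ FIJ.
rewrite (big_setID J) [leRHS](big_setID I) /= finset.setIC lerD2l.
have [K0|[i0 Hi0]] := set_0Vmem (I :\: J).
  by rewrite K0 big_set0; apply: sumr_ge0.
pose c := \big[Num.max/0]_(i in I :\: J) F i.
apply: (@le_trans _ _ (c *+ #|I :\: J|)).
  rewrite -sumr_const; apply: ler_sum => i iIJ.
  exact: (le_bigmax_cond 0 F iIJ).
apply: (@le_trans _ _ (c *+ #|J :\: I|)).
  rewrite ler_wpMn2l //; first exact: bigmax_ge_id.
  by rewrite -(leq_add2l #|I :&: J|) cardsID finset.setIC cardsID.
rewrite -sumr_const; apply: ler_sum => j jJI.
by apply: bigmax_le => // i iIJ; exact: FIJ.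
Qed.

(** Together with sellnorm_restrict this exhibits ||u||_{s,p} as a maximum over
    index sets chosen independently of u. *)
Lemma ellnorm_restrict_le I u : (#|I| <= s)%N ->
  ellnorm p (restrict I u) <= sellnorm s p u.
Proof.
move=> Is; rewrite /sellnorm -/(restrict _ u).
set J := largest s _.
have IJ : (#|I| <= #|J|)%N by rewrite card_largest.
have FIJ i j : i \in I :\: J -> j \in J :\: I -> `|u i 0| <= `|u j 0|.
  rewrite !finset.in_setD => /andP[iJ _] /andP[_ jJ].
  exact: (largestP jJ iJ).
case: p p1 => [r r1||//].
- have r0 : 0 < r by rewrite (lt_le_trans ltr01) -?lee_fin.
  have sumE K : \sum_i `|restrict K u i 0| `^ r = \sum_(i in K) `|u i 0| `^ r.
    rewrite [RHS]big_mkcond; apply: eq_bigr => i _; rewrite mxE.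
    by case: ifP => // _; rewrite normr0 powR0 ?gt_eqF.
  rewrite /ellnorm ge0_ler_powR ?invr_ge0 ?(ltW r0) ?nnegrE ?sumr_ge0//;
    try by move=> i _; exact: powR_ge0.
  rewrite !sumE; apply: ler_sum_dominating => // i j iI jJ.
  by rewrite ge0_ler_powR ?nnegrE ?(ltW r0)// FIJ.
- move=> _; apply: bigmax_le => [|i _]; first exact: ellnorm_ge0.
  rewrite mxE; case: ifP => iI; last by rewrite normr0 ellnorm_ge0.
  have maxJ j : j \in J -> `|u j 0| <= ellnorm +oo%E (restrict J u).
    move=> jJ; apply: le_trans (le_bigmax _ _ j).
    by rewrite mxE jJ.
  have [iJ|iJ] := boolP (i \in J); first exact: maxJ.
  (* As i lies in I but not in J and |I| <= |J|, some j lies in J but not in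
     I; its entry dominates that of i. *)
  have : (0 < #|J :\: I|)%N.
    rewrite lt0n; apply/eqP => JI0; move: IJ; rewrite leqNgt => /negP; apply.
    rewrite -(cardsID J I) -(cardsID I J) JI0 addn0 finset.setIC.
    rewrite -{1}[#|_ :&: _|]addn0.
    by rewrite ltn_add2l card_gt0; apply/set0Pn; exists i; rewrite inE iJ.
  rewrite card_gt0 => /set0Pn[j jJI].
  apply: (@le_trans _ _ `|u j 0|); first by apply: FIJ; rewrite // inE iJ.
  by apply: maxJ; move: jJI; rewrite inE => /andP[].
Qed.

Lemma sellnorm_le u v : (forall i, `|u i 0| <= `|v i 0|) ->
  sellnorm s p u <= sellnorm s p v.
Proof.
move=> uv; have [J Js ->] := sellnorm_restrict u.
apply: (@le_trans _ _ (ellnorm p (restrict J v))); last first.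
  by rewrite ellnorm_restrict_le ?Js.
by apply: ellnorm_le => // i; rewrite !mxE; case: ifP; rewrite ?normr0.
Qed.

Lemma sellnorm_seminorm : is_seminorm (@sellnorm R s p d).
Proof.
split=> [a u|u v].
  apply/eqP; rewrite eq_le; apply/andP; split.
    have [J Js ->] := sellnorm_restrict (a *: u).
    by rewrite restrictZ ellnormZ// ler_wpM2l// ellnorm_restrict_le ?Js.
  have [J Js ->] := sellnorm_restrict u.
  by rewrite -ellnormZ// -restrictZ ellnorm_restrict_le ?Js.
have [J Js ->] := sellnorm_restrict (u + v).
rewrite restrictD; apply: le_trans (proj2 (ellnorm_seminorm d p1) _ _) _.
by apply: lerD; rewrite ellnorm_restrict_le ?Js.
Qed.

Lemma ellnorm_ge_entry u i : `|u i 0| <= ellnorm p u.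
Proof.
case: p p1 => [r r1||//]; last by move=> _; exact: le_bigmax.
have r0 : 0 < r by rewrite (lt_le_trans ltr01) -?lee_fin.
rewrite -[leLHS](powRr1 (normr_ge0 _)) -(mulfV (lt0r_neq0 r0)) powRrM.
rewrite /ellnorm ge0_ler_powR ?invr_ge0 ?(ltW r0) ?nnegrE ?powR_ge0 ?sumr_ge0//.
rewrite (bigD1 i)//= lerDl sumr_ge0// => j _; exact: powR_ge0.
Qed.

Lemma sellnorm_ge_entry u i : (0 < s)%N -> `|u i 0| <= sellnorm s p u.
Proof.
move=> s0; apply: (@le_trans _ _ (ellnorm p (restrict [set i] u))).
  by apply: le_trans (ellnorm_ge_entry _ i); rewrite mxE finset.set11.
by rewrite ellnorm_restrict_le// cards1.
Qed.

(** Each of the s retained entries is at most the maximum. *)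
Lemma sellnorm_le_max u :
  sellnorm s p u <= s%:R `^ invexp p * ellnorm +oo%E u.
Proof.
have [J Js ->] := sellnorm_restrict u.
have uM i : `|u i 0| <= ellnorm +oo%E u by exact: le_bigmax.
have M0 := ellnorm_ge0 +oo%E u.
case: p p1 => [r r1||//] /=.
- have r0 : 0 < r by rewrite (lt_le_trans ltr01) -?lee_fin.
  rewrite -/(ellnorm +oo%E u); set M := ellnorm +oo%E u.
  have {1}-> : M = (M `^ r) `^ r^-1.
    by rewrite -powRrM mulfV ?lt0r_neq0// powRr1.
  rewrite -powRM ?powR_ge0//.
  rewrite ge0_ler_powR ?invr_ge0 ?(ltW r0) ?nnegrE ?mulr_ge0 ?powR_ge0//.
    by apply: sumr_ge0 => i _; exact: powR_ge0.
  rewrite mulr_natl -Js -sumr_const [leRHS]big_mkcond /=; apply: ler_sum => i _.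
  rewrite mxE; case: ifP => iJ; last by rewrite normr0 powR0 ?gt_eqF.
  by rewrite ge0_ler_powR ?nnegrE ?(ltW r0).
- move=> oo1; rewrite powRr0 mul1r.
  by apply: (ellnorm_le oo1) => i; rewrite mxE; case: ifP; rewrite ?normr0.
Qed.

End SEllNorm.

(** * Block vectors *)

Section BlockNorms.
Variables (R : realType) (n : nat) (S : repr_struct R n).
Local Notation K := (nblocks S).
Local Notation N := (\sum_(k < nblocks S) bdim S k)%N.
Implicit Types (w : 'cV[R]_N) (V : 'M[R]_N).

Lemma bnorm_seminorm k : is_seminorm (bnorm S k).
Proof. exact/is_norm_seminorm/bnormP. Qed.

Lemma bmag_ge0 w k : 0 <= bmag w k.
Proof. exact/seminorm_ge0/bnorm_seminorm. Qed.

(** Monotonicity of f is what lets the blockwise triangle inequality pass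
    through f. *)
Lemma blockwise_seminorm (f : 'cV[R]_K -> R) : is_seminorm f ->
  (forall u v : 'cV_K, (forall k, `|u k 0| <= `|v k 0|) -> f u <= f v) ->
  is_seminorm (fun w => f (\col_k bmag w k)).
Proof.
move=> hf fle; split=> [a w|w w'].
  rewrite -[`|a|]normr_id -(proj1 hf); congr f.
  apply/matrixP => k j; rewrite !mxE /bmag.
  rewrite -(proj1 (bnorm_seminorm k)); congr bnorm.
  by apply/matrixP => x y; rewrite !mxE.
apply: le_trans (proj2 hf _ _); apply: fle => k; rewrite !mxE.
rewrite ger0_norm ?bmag_ge0// ger0_norm ?addr_ge0 ?bmag_ge0//.
by rewrite /bmag submxcolD (proj2 (bnorm_seminorm k)).
Qed.

Lemma LspE s q w : Lsp s q w = sellnorm s q (\col_k bmag w k).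
Proof.
rewrite /Lsp /Lp /sellnorm; congr ellnorm; apply/matrixP => k j; rewrite !mxE.
have -> : (fun i => `|(\col_k0 bmag w k0) i 0|) = bmag w.
  by apply/funext => i; rewrite mxE ger0_norm ?bmag_ge0.
rewrite {1}/bmag /btrunc mxcolK; case: ifP => // _.
exact/seminorm0/bnorm_seminorm.
Qed.

Lemma Lp_oo_is_norm : is_norm (Lp (S := S) +oo%E).
Proof.
have [||hZ hD] := @blockwise_seminorm (@ellnorm R +oo%E K).
- by apply: ellnorm_seminorm; rewrite leey.
- by move=> u v; apply: ellnorm_le; rewrite leey.
split=> // w w0; rewrite -(submxcolK w) -mxcol0; apply: eq_mxcol => k.
case: (bnormP k) => bn0 _ _; apply: bn0.
apply/eqP; rewrite eq_le bmag_ge0 andbT -w0.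
apply: le_trans (ellnorm_ge_entry _ _ k); last by rewrite leey.
by rewrite mxE ger0_norm ?bmag_ge0.
Qed.

Lemma Lp1E w : Lp 1%:E w = \sum_k bmag w k.
Proof.
rewrite /Lp /ellnorm invr1 powRr1; last first.
  by apply: sumr_ge0 => k _; exact: powR_ge0.
by apply: eq_bigr => k _; rewrite mxE powRr1// ger0_norm ?bmag_ge0.
Qed.

Section Exponent.
Variables (s : nat) (q : \bar R).
Hypotheses (s_le : (s <= K)%N) (q1 : (1%:E <= q)%E).

Lemma Lsp_seminorm : is_seminorm (Lsp (S := S) s q).
Proof.
have -> : Lsp (S := S) s q = fun w => sellnorm s q (\col_k bmag w k).
  by apply/funext => w; exact: LspE.
apply: blockwise_seminorm; first exact: sellnorm_seminorm.
by move=> u v; exact: sellnorm_le.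
Qed.

Lemma Lsp_le_Lp_oo w : Lsp s q w <= s%:R `^ invexp q * Lp +oo%E w.
Proof. by rewrite LspE; exact: sellnorm_le_max. Qed.

Lemma nuvalE V l u : nuval s q V u = Lsp s q (submxrow V l *m u).
Proof.
congr Lsp; apply/mxcolP => k; rewrite mxcolK -submxcol_mul; congr (_ *m _).
by rewrite submxblockEh.
Qed.

Lemma nuval_seminorm V l : is_seminorm (@nuval R n S s q V l).
Proof.
have -> : @nuval R n S s q V l = fun u => Lsp s q (submxrow V l *m u).
  by apply/funext => u; exact: nuvalE.
exact: (seminorm_comp Lsp_seminorm (mulmx (submxrow V l))).
Qed.

Lemma bmag_nuval V l (u : 'cV[R]_(bdim S l)) k :
  bmag (\mxcol_k (submxblock V k l *m u)) k = bnorm S k (submxblock V k l *m u).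
Proof. by rewrite /bmag mxcolK. Qed.

Lemma block_image_seminorm V k l :
  is_seminorm (fun u => bnorm S k (submxblock V k l *m u)).
Proof. exact: (seminorm_comp (bnorm_seminorm k) (mulmx (submxblock V k l))). Qed.

Lemma Omega_ge0 V k l : 0 <= Omega V k l.
Proof.
by rewrite mxE; exact: ball_sup_ge0 (bnormP l) (block_image_seminorm V k l).
Qed.

Lemma block_image_le_Omega V k l u : bnorm S l u <= 1 ->
  bnorm S k (submxblock V k l *m u) <= Omega V k l.
Proof.
rewrite mxE => ul.
exact: (ball_sup_ub (bnormP l) (block_image_seminorm V k l) ul).
Qed.

Lemma Omega_attained V k l : exists2 u, bnorm S l u <= 1 &
  Omega V k l = bnorm S k (submxblock V k l *m u).
Proof.
rewrite mxE.
exact: (ball_sup_attained (bnormP l) (block_image_seminorm V k l)).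
Qed.

Lemma nuhat_ge0 V : 0 <= nuhat s q V.
Proof. exact: bigmax_ge_id. Qed.

Lemma nustar_le_nuhat V : nustar s q V <= nuhat s q V.
Proof.
apply: bigmax_le => [|l _]; first exact: nuhat_ge0.
have [u fu ->] := ball_sup_attained (bnormP l) (nuval_seminorm V l).
apply: le_trans (le_bigmax _ _ l); rewrite /nuval LspE.
apply: sellnorm_le => // k; rewrite [X in `|X|]mxE bmag_nuval [col _ _ _ _]mxE.
rewrite ger0_norm ?(ger0_norm (Omega_ge0 _ _ _)); last first.
  exact/seminorm_ge0/bnorm_seminorm.
exact: block_image_le_Omega.
Qed.

(** The hypothesis s^{1/q} = 1 covers q = oo and s = 1 at once; under it
    ||.||_{s,q} does not exceed the max norm. *)
Lemma nuhat_le_nustar V : (0 < s)%N -> s%:R `^ invexp q = 1 :> R ->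
  nuhat s q V <= nustar s q V.
Proof.
move=> s_gt0 sq1; apply: bigmax_le => [|l _]; first exact: bigmax_ge_id.
apply: le_trans (sellnorm_le_max s_le q1 _) _; rewrite sq1 mul1r.
apply: bigmax_le => [|k _]; first exact: bigmax_ge_id.
apply: le_trans (le_bigmax _ _ l).
rewrite mxE ger0_norm ?Omega_ge0//; have [u fu ->] := Omega_attained V k l.
apply: le_trans (ball_sup_ub (bnormP l) (nuval_seminorm V l) fu).
rewrite /nuval LspE -bmag_nuval.
apply: le_trans (sellnorm_ge_entry s_le q1 _ k s_gt0).
by rewrite mxE ger0_norm ?bmag_ge0.
Qed.

(** V w is the sum over l of the l-th block column of V applied to w[l], and
    each of these images is controlled by the l-th supremum in nu^*. *)
Lemma Lsp_mulmx_le V w : Lsp s q (V *m w) <= nustar s q V * Lp 1%:E w.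
Proof.
have -> : V *m w = \sum_l submxrow V l *m submxcol w l.
  by rewrite -mul_mxrow_mxcol submxrowK submxcolK.
rewrite Lp1E mulr_sumr; apply: le_trans (seminorm_sum Lsp_seminorm _) _.
apply: ler_sum => l _; rewrite -nuvalE.
apply: le_trans (ball_sup_le (bnormP l) (nuval_seminorm V l) _) _.
by rewrite ler_wpM2r ?bmag_ge0//; exact: le_bigmax.
Qed.

End Exponent.
End BlockNorms.

(* The first conjunct says that the inner supremum defining nustar is a
   maximum. *)
Theorem proposition5p2 (R : realType) (m n : nat) (A : 'M[R]_(m, n))
    (S : repr_struct R n) (s : nat) (s_gt0 : (0 < s)%N)
    (s_le : (s <= nblocks S)%N) (q : \bar R) (q_ge1 : (1%:E <= q)%E)
    (kappa : R) (kappa_ge0 : 0 <= kappa) :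
  [/\ forall (V : 'M[R]_(\sum_(k < nblocks S) bdim S k)) (l : 'I_(nblocks S)),
        exists2 u : 'cV[R]_(bdim S l), bnorm S l u <= 1 &
          forall u' : 'cV[R]_(bdim S l), bnorm S l u' <= 1 ->
            nuval s q V u' <= nuval s q V u,
      forall V : 'M[R]_(\sum_(k < nblocks S) bdim S k),
        nustar s q V <= nuhat s q V,
      q = +oo%E \/ s = 1%N ->
        forall V : 'M[R]_(\sum_(k < nblocks S) bdim S k),
          nuhat s q V = nustar s q V
    & forall H : 'M[R]_(m, \sum_(k < nblocks S) bdim S k),
        (exists V : 'M[R]_(\sum_(k < nblocks S) bdim S k),
          rsB S = V *m rsB S + H^T *m A /\
          nuhat s q V <= s%:R `^ (invexp q - 1) * kappa) ->
        condQ S A s q kappa H (Lp (S := S) +oo%E)].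
Proof.
split=> [V l|V|sq V|H [V [BE Vk]]].
- exact: ball_max (bnormP l) (nuval_seminorm s_le q_ge1 V l).
- exact: nustar_le_nuhat.
- apply/eqP; rewrite eq_le nustar_le_nuhat// andbT nuhat_le_nustar//.
  by case: sq => ->; rewrite ?powR1// powRr0.
- split=> [|x]; first exact: Lp_oo_is_norm.
  have {1}-> : rsB S *m x = H^T *m A *m x + V *m (rsB S *m x).
    by rewrite {1}BE mulmxDl addrC mulmxA.
  apply: le_trans (proj2 (Lsp_seminorm s_le q_ge1) _ _) _.
  apply: lerD; first exact: Lsp_le_Lp_oo.
  apply: le_trans (Lsp_mulmx_le s_le q_ge1 _ _) _.
  apply: ler_wpM2r; first exact: ellnorm_ge0.
  by rewrite [leRHS]mulrC (le_trans _ Vk)// nustar_le_nuhat.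
Qed.
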